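(* Let $S$ be a holomorphic semigroup and $\beta S$ the set of all ultrafilters on $S$. For $A\subseteq S$ and $f\in S$ let $A\circ f = \{g\in S : g\circ f\in A\}$, and for $\mathscr{E},\mathscr{F}\in\beta S$ let $$\mathscr{E}\star\mathscr{F} = \{A\subseteq S : \{f\in S : A\circ f\in\mathscr{E}\}\in\mathscr{F}\}.$$ Then for any $\mathscr{E},\mathscr{F}\in\beta S$, $\mathscr{E}\star\mathscr{F}$ is an ultrafilter on $S$, and the operation $\star$ on $\beta S$ is associative.
   Context: A holomorphic semigroup $S$ is a non-empty set of holomorphic self-maps of a fixed set $X$ (where $X$ is $\mathbb{C}$, the Riemann sphere $\mathbb{C}_\infty$, or a fixed open subset thereof) that is closed under composition $\circ$. A filter on $S$ is a non-empty family $\mathscr{F}$ of subsets of $S$ such that $\emptyset\notin\mathscr{F}$; $A\in\mathscr{F}$ and $A\subseteq B \subseteq S$ imply $B\in\mathscr{F}$; and $A,B\in\mathscr{F}$ imply $A\cap B\in\mathscr{F}$. A filter $\mathscr{F}$ is an ultrafilter if whenever $S = A_1\cup\dots\cup A_n$ for some $n\in\mathbb{N}$ and subsets $A_i \subseteq S$, then $A_i\in\mathscr{F}$ for some $1\le i\le n$; equivalently, for every $E\subseteq S$ either $E\in\mathscr{F}$ or $S\setminus E\in\mathscr{F}$. Note that $A \circ f$ denotes the preimage of $A$ under $g\mapsto g\circ f$. *)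

(* Defs.v *)
From HB Require Import structures.
From mathcomp Require Import all_boot all_order all_algebra.
From mathcomp Require Import all_classical all_reals all_analysis.
From mathcomp Require Import complex.

Set Implicit Arguments.
Unset Strict Implicit.
Unset Printing Implicit Defensive.

Import GRing.Theory Num.Theory.
Import numFieldNormedType.Exports.

Local Open Scope classical_set_scope.
Local Open Scope ring_scope.

Section Ultrafilters.
Variable T : Type.
Implicit Types F G : set_system T.

Definition ultrafilter F : Prop :=
  ProperFilter F /\
  forall (n : nat) (A : 'I_n -> set T),
    \bigcup_(i in [set: 'I_n]) A i = [set: T] -> exists i, F (A i).

Lemma ultrafilter_setVsetC F :
  ultrafilter F <-> ProperFilter F /\ forall E, F E \/ F (~` E).
Proof.
split=> -[FF ultraF]; split=> //.
  move=> E; have [|i] := ultraF 2 (fun i => if i == ord0 then E else ~` E).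
    apply/seteqP; split=> x // _; have [Ex|nEx] := pselect (E x).
      by exists ord0.
    by exists ord_max.
  by case: ifP => _ ?; [left|right].
move=> n A AT; apply: contrapT => /forallNP nFA.
have : \forall x \near F, forall i, (~` A i) x.
  by apply: filter_forall => i; have [/nFA|] := ultraF (A i).
case/(@filter_ex _ F _) => x nAx.
have [i _ Aix] : (\bigcup_(i in [set: 'I_n]) A i) x by rewrite AT.
exact: nAx Aix.
Qed.

Lemma ultrafilter_UltraFilter F : ultrafilter F <-> UltraFilter F.
Proof.
rewrite ultrafilter_setVsetC; split=> [[FF ultraF]|FU].
  split=> // G GF FG; apply/seteqP; split=> // A GA.
  have [//|/FG GnA] := ultraF A.
  by case: (@filter_not_empty _ G _); rewrite -(setICr A); exact: filterI.
by split=> [|E]; [exact: ultra_proper|exact: in_ultra_setVsetC].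
Qed.

End Ultrafilters.

Section HolomorphicSemigroup.
Variable R : realType.
(* [R[i]] itself carries no topology; its regular module [R[i]^o] has the one
   given by the modulus. *)
Local Notation C := (R[i]^o).

Definition sphere : topologicalType := one_point_compactification C.

Implicit Type X : set sphere.

(* [chart false] parametrizes the finite plane by z |-> z and [chart true] the
   complement of 0 by w |-> 1/w, with 0 |-> oo. *)
Definition chart (b : bool) (z : C) : sphere :=
  if b then (if z == 0 then None else Some z^-1) else Some z.

(* Left inverse of [chart b]; irrelevant outside [range (chart b)]. *)
Definition chart_inv (b : bool) (p : sphere) : C :=
  match p with
  | Some z => if b then z^-1 else z
  | None => 0
  end.

Lemma chartK b : cancel (chart b) (chart_inv b).
Proof.
by case: b => z //=; rewrite /chart; case: eqP => [->|_] //=; rewrite invrK.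
Qed.

Lemma range_chart_false : range (chart false) = ~` [set None].
Proof.
by apply/seteqP; split=> [_ [z _ <-] //|[z|] //= _]; exists z.
Qed.

Lemma range_chart_true : range (chart true) = ~` [set Some 0].
Proof.
apply/seteqP; split=> [_ [z _ <-]|[z|] /= z0].
- by rewrite /chart /=; case: eqP => //= z0 [] /eqP; rewrite invr_eq0 => /eqP.
- exists z^-1 => //; rewrite /chart invr_eq0 invrK.
  by case: eqP => // zE; case: z0; rewrite zE.
- by exists 0 => //; rewrite /chart eqxx.
Qed.

(* Continuous, and complex differentiable when read in any two charts. [f] is
   extended by oo outside [X] only in order to be read in charts: for [X] open
   the extension has no effect on differentiability at the points of [X]. *)
Definition holomorphic X (f : X -> X) : Prop :=
  continuous f /\
  forall (a b : bool) (z : C) (Xz : chart a z \in X),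
    range (chart b) (set_val (f (SigSub Xz))) ->
    derivable (chart_inv b \o 'valL_ None (set_val \o f) \o chart a) z 1.

Record holomorphic_semigroup X := HolomorphicSemigroup {
  hs_set :> set (X -> X);
  hs_nonempty : hs_set !=set0;
  hs_holomorphic : forall f, hs_set f -> holomorphic f;
  hs_closed : forall f g, hs_set f -> hs_set g -> hs_set (f \o g)
}.

Section Star.
Variables (X : set sphere) (S : holomorphic_semigroup X).

Definition hs_comp (f g : S) : S :=
  SigSub (mem_set (hs_closed (set_valP f) (set_valP g))).

Definition beta : set (set_system S) := [set F | ultrafilter F].

Definition rpreimage (A : set S) (f : S) : set S := [set g | A (hs_comp g f)].

Definition star (E F : set_system S) : set_system S :=
  [set A | F [set f | E (rpreimage A f)]].

End Star.

End HolomorphicSemigroup.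

Arguments beta {R X} S _.

(* Main.v *)
Require Import Defs.
From HB Require Import structures.
From mathcomp Require Import all_boot all_order all_algebra.
From mathcomp Require Import all_classical all_reals all_analysis.
From mathcomp Require Import complex.

Local Open Scope classical_set_scope.

(** Read [F A] as: [F]-almost every element lies in [A]. Then [star E F A] says that for [F]-almost
    every [f] and [E]-almost every [g], the composite of [g] after [f] lies in [A]. Such quantifiers
    respect inclusions and intersections, and for ultrafilters also complements, whence
    [star_ultrafilter]. In [starA] both bracketings unfold to the same triple quantifier, over [G],
    then [F], then [E]. *)

Lemma hs_compA (R : realType) (X : set (sphere R))
    (S : holomorphic_semigroup X) :
  associative (@hs_comp R X S).
Proof. by move=> f g h; apply: val_inj. Qed.

(** This is where associativity of composition enters the associativity of [star]. *)
Lemma rpreimage_comp (R : realType) (X : set (sphere R))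
    (S : holomorphic_semigroup X) (A : set S) (f h : S) :
  rpreimage (rpreimage A h) f = rpreimage A (hs_comp f h).
Proof.
by apply/seteqP; split=> g; rewrite /rpreimage /= hs_compA.
Qed.

Lemma star_proper (R : realType) (X : set (sphere R))
    (S : holomorphic_semigroup X) (E F : set_system S) :
  ProperFilter E -> ProperFilter F -> ProperFilter (star E F).
Proof.
move=> EE FF; split; first by rewrite /star /= => /filter_ex[f] /filter_ex[].
split; rewrite /star /=.
- by apply: filterE => f; exact: filterT.
- by move=> A B /=; apply: filterS2 => f; exact: filterI.
- by move=> A B AB /=; apply: filterS => f; apply: filterS => g; exact: AB.
Qed.

Lemma star_ultrafilter (R : realType) (X : set (sphere R))
    (S : holomorphic_semigroup X) (E F : set_system S) :
  ultrafilter E -> ultrafilter F -> ultrafilter (star E F).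
Proof.
rewrite !ultrafilter_setVsetC => -[EE ultraE] [FF ultraF].
split=> [|A]; first exact: star_proper.
have [|FnA] := ultraF [set f | E (rpreimage A f)]; [by left|right].
(* Preimages commute with complements by computation, so the second alternative of [ultraE] is
   already the goal. *)
by apply: filterS FnA => f nEA; have [/nEA|] := ultraE (rpreimage A f).
Qed.

Lemma starA (R : realType) (X : set (sphere R))
    (S : holomorphic_semigroup X) :
  associative (@star R X S).
Proof.
move=> E F G; apply/funext => A; congr G; apply/funext => h; congr F.
(* With [G], [F] and [E] peeled off, the preimage of [A] under [h] and then [f] is compared with
   that under [hs_comp f h]. *)
by apply/funext => f; congr E; rewrite rpreimage_comp.
Qed.

Theorem theorem3p2 (R : realType) (X : set (sphere R)) (hX : open X)
    (S : holomorphic_semigroup X) :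
  (forall E F : set_system S, beta S E -> beta S F -> beta S (star E F)) /\
  (forall E F G : set_system S, beta S E -> beta S F -> beta S G ->
     star (star E F) G = star E (star F G)).
Proof.
by split=> [E F|E F G _ _ _]; [exact: star_ultrafilter|rewrite starA].
Qed.
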